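(* Let $I$ be a squarefree monomial ideal of $R=\Bbbk[x_1,\ldots,x_n]$. Let $F_\bullet$ be a minimal (multigraded) DG $\Gamma$-algebra free resolution of $R/I$. If $e_\sigma$ is a basis element, of even positive homological degree, of the algebraic Scarf complex of $I$ (viewed as a subcomplex of $F_\bullet$) corresponding to a standard basis element of the Taylor resolution, then $e_\sigma^{(m)}=0$ for all $m\geq2$.
   Context: Conventions. $\Bbbk$ is a field and $R=\Bbbk[x_1,\ldots,x_n]$ is $\mathbb{Z}^n$-graded with $\deg x_i$ the $i$-th standard basis vector. All complexes over $R$ are bigraded: $|x|$ is the homological degree of $x$, and the internal (multi)degree $\deg x$ is denoted by the unique monomial of $R$ with the same $\mathbb{Z}^n$-degree. ''Bihomogeneous'' means homogeneous for both gradings. DG algebra. A DG algebra over $R$ is a complex $A$ of finitely generated free $R$-modules with differential $\partial$ and a unitary associative multiplication respecting both gradings such that, for homogeneous $a,b$: $\partial(ab)=\partial(a)b+(-1)^{|a|}a\partial(b)$; $ab=(-1)^{|a||b|}ba$; and $a^2=0$ if $|a|$ is odd. DG $\Gamma$-algebra. A DG algebra $A$ is a DG $\Gamma$-algebra if to every bihomogeneous $x\in A$ of even positive homological degree there is associated a sequence $x^{(k)}\in A$, $k=0,1,2,\ldots$, satisfying: (1) $x^{(0)}=1$, $x^{(1)}=x$, $|x^{(k)}|=k|x|$, $\deg x^{(k)}=(\deg x)^k$; (2) $x^{(h)}x^{(k)}=\binom{h+k}{h}x^{(h+k)}$; (3) if $x,y$ have the same bidegree, $(x+y)^{(k)}=\sum_{i+j=k}x^{(i)}y^{(j)}$;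 (4) for $k\ge2$ and $x,y$ bihomogeneous, $(xy)^{(k)}=0$ if $|x|$ and $|y|$ are odd, and $(xy)^{(k)}=x^ky^{(k)}$ if $|x|$ is even and $|y|$ is even and positive; (5) $(x^{(h)})^{(k)}=\frac{(hk)!}{k!(h!)^k}x^{(hk)}$; (6) $\partial(x^{(k)})=x^{(k-1)}\partial(x)$ for $k\ge1$. Taylor resolution and Scarf complex. Let $u_1,\ldots,u_r$ be the minimal monomial generators of $I$, and for $\sigma\subseteq[r]=\{1,\ldots,r\}$ let $m_\sigma$ be the least common multiple of the $u_i$, $i\in\sigma$. The Taylor resolution $T_\bullet$ of $R/I$ has basis $\{e_\sigma:\sigma\subseteq[r]\}$, with $e_\sigma$ of homological degree $|\sigma|$ and multidegree $m_\sigma$, and differential $\partial(e_\sigma)=\sum_{i\in\sigma}(-1)^{|\{j\in\sigma: j<i\}|}\frac{m_\sigma}{m_{\sigma\setminus\{i\}}}e_{\sigma\setminus\{i\}}$. The algebraic Scarf complex is the subcomplex of $T_\bullet$ generated by all basis elements having unique multidegree, i.e. those $e_\sigma$ such that $m_\sigma\neq m_\tau$ for all $\tau\neq\sigma$. It is known to be a subcomplex of the minimal free resolution of $R/I$; via such a multigraded embedding (with $e_\emptyset$ mapping to $1$), its basis elements $e_\sigma$ are regarded as elements of $F_\bullet$. *)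

(* Defs.v *)
From mathcomp Require Import all_boot all_order all_algebra.
From mathcomp Require Import mpoly.

Set Implicit Arguments.
Unset Strict Implicit.
Unset Printing Implicit Defensive.

Import GRing.Theory.
Local Open Scope ring_scope.

(* The internal degree of a homogeneous element is recorded as a monomial, that
   is, an exponent vector in 'X_{1..n}.  On 'X_{1..n}, (m1 <= m2)%MM is
   divisibility, (m1 + m2)%MM the product, (m *+ k)%MM the k-th power, and
   (m2 - m1)%MM the quotient when m1 divides m2. *)

(* [bg_carrier] is the direct sum, over all homological degrees i, of the free
   modules of rank [bg_rank i] with bihomogeneous basis [bg_basis i]. *)
Record bigraded_free (k : fieldType) (n : nat) := BigradedFree {
  bg_carrier :> lmodType {mpoly k[n]};
  bg_rank : nat -> nat;
  bg_basis : forall i, 'I_(bg_rank i) -> bg_carrier;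
  bg_deg : forall i, 'I_(bg_rank i) -> 'X_{1..n};
  bg_span : forall x : bg_carrier,
    exists (N : nat) (c : forall i, 'I_(bg_rank i) -> {mpoly k[n]}),
      x = \sum_(i < N) \sum_j c i j *: bg_basis j;
  bg_free : forall (N : nat) (c : forall i, 'I_(bg_rank i) -> {mpoly k[n]}),
    \sum_(i < N) \sum_j c i j *: bg_basis j = 0 ->
    forall i (j : 'I_(bg_rank i)), (i < N)%N -> c i j = 0
}.

Section Homogeneous.
Variables (k : fieldType) (n : nat) (A : bigraded_free k n).

Definition hhom (i : nat) (x : A) : Prop :=
  exists c : 'I_(bg_rank A i) -> {mpoly k[n]},
    x = \sum_j c j *: bg_basis j.

Definition bihom (i : nat) (m : 'X_{1..n}) (x : A) : Prop :=
  exists c : 'I_(bg_rank A i) -> k,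
    x = \sum_(j | (bg_deg j <= m)%MM)
          (c j *: 'X_[k, (m - bg_deg j)%MM]) *: bg_basis j.

End Homogeneous.

Record bigraded_complex (k : fieldType) (n : nat) := BigradedComplex {
  bc_module :> bigraded_free k n;
  diff : {linear bc_module -> bc_module};
  diff_bihom : forall i m (x : bc_module),
    bihom i.+1 m x -> bihom i m (diff x);
  diff_bihom0 : forall m (x : bc_module), bihom 0 m x -> diff x = 0;
  diffK : forall x, diff (diff x) = 0
}.

Definition minimal (k : fieldType) (n : nat) (F : bigraded_complex k n) : Prop :=
  forall x : F, exists y : 'I_n -> F, diff F x = \sum_v 'X_v *: y v.

(* Exactness of ... -> F_1 -> F_0 -> R/I -> 0.  Since F_0 is graded free, the
   graded augmentation F_0 -> R/I is represented by a graded lift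
   [eps : F_0 -> R]; equality in R/I is membership of a difference in [I]. *)
Definition free_resolution (k : fieldType) (n : nat)
    (I : {mpoly k[n]} -> Prop) (F : bigraded_complex k n) : Prop :=
  (forall i (x : F), hhom i.+1 x -> diff F x = 0 ->
     exists y : F, hhom i.+2 y /\ diff F y = x) /\
  (exists eps : {linear F -> {mpoly k[n]}^o},
     [/\ forall m (x : F), bihom 0 m x -> exists c : k, eps x = c *: 'X_[m],
         forall f : {mpoly k[n]}, exists x : F, hhom 0 x /\ I (f - eps x)
       & forall x : F, hhom 0 x ->
           (I (eps x) <-> exists y : F, hhom 1 y /\ diff F y = x)]).

(* The product is a field rather than an [algType] structure because the latter
   forces 1 != 0, excluding the zero algebra (the minimal resolution of R/R). *)
Record dg_algebra (k : fieldType) (n : nat) := DgAlgebra {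
  dg_complex :> bigraded_complex k n;
  dmul : dg_complex -> dg_complex -> dg_complex;
  dunit : dg_complex;
  dmul_linearl : forall b, linear (dmul^~ b);
  dmul_linearr : forall a, linear (dmul a);
  dmulA : associative dmul;
  dmul1l : left_id dunit dmul;
  dmul1r : right_id dunit dmul;
  dunit_bihom : bihom 0 0%MM dunit;
  dmul_bihom : forall i j m m' (a b : dg_complex),
    bihom i m a -> bihom j m' b -> bihom (i + j) (m + m')%MM (dmul a b);
  dmul_leibniz : forall i j (a b : dg_complex), hhom i a -> hhom j b ->
    diff dg_complex (dmul a b) =
      dmul (diff dg_complex a) b + (-1) ^+ i *: dmul a (diff dg_complex b);
  dmulC : forall i j (a b : dg_complex), hhom i a -> hhom j b ->
    dmul a b = (-1) ^+ (i * j) *: dmul b a;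
  dmul_odd : forall i (a : dg_complex), hhom i a -> odd i -> dmul a a = 0
}.

Definition dexp (k : fieldType) (n : nat) (A : dg_algebra k n)
    (x : A) (e : nat) : A := iter e (dmul x) (dunit A).

Definition even_pos (i : nat) : bool := ~~ odd i && (0 < i)%N.

(* [dpow x e] is the divided power x^(e).  It is a total function, but only its
   values at bihomogeneous x of even positive homological degree are
   constrained.  In [dpow_dpow], h is positive: otherwise x^(h) = 1 has degree 0
   and no divided powers. *)
Record dg_gamma_algebra (k : fieldType) (n : nat) := DgGammaAlgebra {
  dga_algebra :> dg_algebra k n;
  dpow : dga_algebra -> nat -> dga_algebra;
  dpow0 : forall i m (x : dga_algebra), even_pos i -> bihom i m x ->
    dpow x 0 = dunit dga_algebra;
  dpow1 : forall i m (x : dga_algebra), even_pos i -> bihom i m x ->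
    dpow x 1 = x;
  dpow_bihom : forall i m (x : dga_algebra) e, even_pos i -> bihom i m x ->
    bihom (e * i) (m *+ e)%MM (dpow x e);
  dpow_mul : forall i m (x : dga_algebra) h e, even_pos i -> bihom i m x ->
    dmul (dpow x h) (dpow x e) = dpow x (h + e) *+ 'C(h + e, h);
  dpow_add : forall i m (x y : dga_algebra) e, even_pos i ->
    bihom i m x -> bihom i m y ->
    dpow (x + y) e = \sum_(s < e.+1) dmul (dpow x s) (dpow y (e - s));
  dpow_prod_odd : forall i j m m' (x y : dga_algebra) e, (2 <= e)%N ->
    odd i -> odd j -> bihom i m x -> bihom j m' y ->
    dpow (dmul x y) e = 0;
  dpow_prod_even : forall i j m m' (x y : dga_algebra) e, (2 <= e)%N ->
    ~~ odd i -> even_pos j -> bihom i m x -> bihom j m' y ->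
    dpow (dmul x y) e = dmul (dexp x e) (dpow y e);
  dpow_dpow : forall i m (x : dga_algebra) h e, (0 < h)%N ->
    even_pos i -> bihom i m x ->
    dpow (dpow x h) e = dpow x (h * e) *+ ((h * e)`! %/ (e`! * h`! ^ e));
  dpow_diff : forall i m (x : dga_algebra) e, (0 < e)%N ->
    even_pos i -> bihom i m x ->
    diff dga_algebra (dpow x e) = dmul (dpow x e.-1) (diff dga_algebra x)
}.

Definition monomial_ideal (k : fieldType) (n r : nat) (u : 'I_r -> 'X_{1..n})
    (s : {set 'I_r}) (f : {mpoly k[n]}) : Prop :=
  exists c : 'I_r -> {mpoly k[n]}, f = \sum_(i in s) c i * 'X_[u i].

Definition squarefree_monomial_ideal (k : fieldType) (n : nat)
    (I : {mpoly k[n]} -> Prop) : Prop :=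
  exists (r : nat) (w : 'I_r -> 'X_{1..n}),
    (forall i v, (w i v <= 1)%N) /\
    (forall f, I f <-> monomial_ideal w [set: 'I_r] f).

Definition minimal_generators (k : fieldType) (n : nat)
    (I : {mpoly k[n]} -> Prop) (r : nat) (u : 'I_r -> 'X_{1..n}) : Prop :=
  (forall f, I f <-> monomial_ideal u [set: 'I_r] f) /\
  (forall s : {set 'I_r},
     (forall f, I f <-> monomial_ideal u s f) -> s = [set: 'I_r]).

(* The regular module R^o is needed here: the default scaling on {mpoly k[n]}
   is by k only. *)
Definition taylor (k : fieldType) (n r : nat) :=
  {ffun {set 'I_r} -> {mpoly k[n]}^o}.

Section Taylor.
Variables (k : fieldType) (n r : nat) (u : 'I_r -> 'X_{1..n}).

Definition lcm_label (s : {set 'I_r}) : 'X_{1..n} :=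
  \big[@mlcm n/0%MM]_(i in s) u i.

Definition taylor_basis (s : {set 'I_r}) : taylor k n r :=
  [ffun t => (t == s)%:R].

Definition taylor_diff (x : taylor k n r) : taylor k n r :=
  \sum_(s : {set 'I_r}) x s *:
    \sum_(i in s)
      ((-1) ^+ #|[set j in s | (j < i)%N]| *
         'X_[k, (lcm_label s - lcm_label (s :\ i))%MM])
      *: taylor_basis (s :\ i).

Definition scarf_face (s : {set 'I_r}) : bool :=
  [forall t : {set 'I_r}, (t != s) ==> (lcm_label s != lcm_label t)].

Definition in_scarf (x : taylor k n r) : Prop :=
  forall s : {set 'I_r}, ~~ scarf_face s -> x s = 0.

(* Only the restriction of [phi] to the Scarf submodule matters; taking [phi]
   linear on all of the Taylor module is no loss, the former being a direct
   summand.  The empty face is Scarf unless the unit monomial is a generator. *)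
Definition scarf_embedding (F : dg_algebra k n)
    (phi : {linear taylor k n r -> F}) : Prop :=
  [/\ forall s, scarf_face s -> bihom #|s| (lcm_label s) (phi (taylor_basis s)),
      forall x, in_scarf x -> diff F (phi x) = phi (taylor_diff x),
      forall x, in_scarf x -> phi x = 0 -> x = 0
    & scarf_face set0 -> phi (taylor_basis set0) = dunit F].

End Taylor.

(* Main.v *)
Require Import Defs.
From mathcomp Require Import all_boot all_order all_algebra.
From mathcomp Require Import mpoly.

Set Implicit Arguments.
Unset Strict Implicit.
Unset Printing Implicit Defensive.

Import GRing.Theory.
Local Open Scope ring_scope.

(** Every subset of a Scarf face is a Scarf face, so the Taylor complex on the
    generators [u_i], [i] in [sigma], embeds in [F].  If [u_i] divides the
    monomial [d] only for [i] in [sigma], this embedding is onto the elements of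
    [F] of internal degree [d]: by induction on the homological degree, the
    boundary of such an element [x] comes from a Taylor cycle, which is a Taylor
    boundary since the strand of degree [d] is a cone, so [x] differs from a
    Taylor element by a boundary, and minimality of [F] allows an induction on
    [d].  As the generators are squarefree, all powers of [m_sigma] are such
    monomials [d].  But [e_sigma^(m)] has homological degree
    [m * #|sigma| > #|sigma|], where this Taylor complex vanishes. *)

(** * Scarf faces and their subsets *)

Section TaylorStrand.
Variables (k : fieldType) (n r : nat) (u : 'I_r -> 'X_{1..n}).

Lemma lcm_label_le (s : {set 'I_r}) (d : 'X_{1..n}) :
  (lcm_label u s <= d)%MM = [forall (i | i \in s), (u i <= d)%MM].
Proof.
rewrite -big_andE /lcm_label.
apply: (big_morph (fun m => (m <= d)%MM)) => [m1 m2|]; first exact: lem_mlcm.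
by apply/mnm_lepP => i; rewrite mnm0E.
Qed.

Lemma lcm_label_ge (s : {set 'I_r}) i : i \in s -> (u i <= lcm_label u s)%MM.
Proof.
move=> si; have := lepm_refl (lcm_label u s).
by rewrite lcm_label_le => /forall_inP; apply.
Qed.

Lemma lcm_label_sub (s t : {set 'I_r}) :
  s \subset t -> (lcm_label u s <= lcm_label u t)%MM.
Proof.
move=> /subsetP st; rewrite lcm_label_le; apply/forall_inP => i /st.
exact: lcm_label_ge.
Qed.

Lemma lepm_antisym (a b : 'X_{1..n}) : (a <= b)%MM -> (b <= a)%MM -> a = b.
Proof.
move=> /mnm_lepP ab /mnm_lepP ba; apply/mnmP => i.
by apply/eqP; rewrite eqn_leq ab ba.
Qed.

(** Otherwise [s] and [i |: s] would be distinct faces with the same label. *)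
Lemma scarf_face_mem (s : {set 'I_r}) i :
  scarf_face u s -> (u i <= lcm_label u s)%MM -> i \in s.
Proof.
move=> /forallP/(_ (i |: s)) sc ui; apply/negPn/negP => nis.
have e : lcm_label u s = lcm_label u (i |: s).
  apply: lepm_antisym; first exact/lcm_label_sub/subsetUr.
  rewrite lcm_label_le; apply/forall_inP => j; rewrite !inE => /orP[/eqP->//|].
  exact: lcm_label_ge.
move: sc; rewrite e eqxx implybF negbK => /eqP es.
by rewrite -es setU11 in nis.
Qed.

Lemma scarf_face_D1 (s : {set 'I_r}) i :
  scarf_face u s -> i \in s -> ~~ (u i <= lcm_label u (s :\ i))%MM.
Proof.
move=> /forallP/(_ (s :\ i)) sc si; apply/negP => ui.
have e : lcm_label u s = lcm_label u (s :\ i).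
  apply: lepm_antisym; last exact/lcm_label_sub/subsetDl.
  rewrite lcm_label_le; apply/forall_inP => j js.
  have [->//|ji] := eqVneq j i.
  by apply: lcm_label_ge; rewrite !inE ji.
move: sc; rewrite e eqxx implybF negbK => /eqP es.
by move: si; rewrite -es !inE eqxx.
Qed.

(** The generators of a face [w] with the label of [t] divide the label of [s], so [w] lies in [s].
    Two subsets of [s] with equal labels coincide, because no generator of [s] divides the lcm of
    the others. *)
Lemma scarf_face_sub (s t : {set 'I_r}) :
  scarf_face u s -> t \subset s -> scarf_face u t.
Proof.
move=> sc /subsetP ts; apply/forallP => w; apply/implyP => wt; apply/negP => /eqP e.
have ws : w \subset s.
  apply/subsetP => i iw; apply: scarf_face_mem sc _.
  apply: lepm_trans (lcm_label_ge iw) _; rewrite -e.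
  exact/lcm_label_sub/subsetP.
have main (a b : {set 'I_r}) : lcm_label u a = lcm_label u b -> a \subset s ->
    b \subset s -> a \subset b.
  move=> eab /subsetP as_ /subsetP bs; apply/subsetP => i ia.
  apply/negPn/negP => nib; have /negP := scarf_face_D1 sc (as_ _ ia); apply.
  apply: lepm_trans (lcm_label_ge ia) _; rewrite eab.
  apply/lcm_label_sub/subsetP => j jb; rewrite !inE bs // andbT.
  by apply: contraNneq nib => <-.
move/subsetP: ts => ts; case/negP: wt; rewrite eqEsubset.
by apply/andP; split; apply: main.
Qed.

(** * Strands of the Taylor complex and their contraction *)

Definition taylor_sign (j : 'I_r) (s : {set 'I_r}) : k :=
  (-1) ^+ #|[set l in s | (l < j)%N]|.

(* The element of degree [d] of the Taylor complex with scalar coefficients [c];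
   truncated subtraction makes it meaningful only if [c] vanishes at the faces
   whose label does not divide [d]. *)
Definition taylor_chain (d : 'X_{1..n}) (c : {set 'I_r} -> k) : taylor k n r :=
  [ffun s => c s *: 'X_[k, (d - lcm_label u s)%MM]].

Definition taylor_strand (sigma : {set 'I_r}) (i : nat) (d : 'X_{1..n})
    (c : {set 'I_r} -> k) : Prop :=
  forall s, c s != 0 -> [/\ s \subset sigma, #|s| = i & (lcm_label u s <= d)%MM].

(** In a single degree [d] the monomials of the Taylor differential factor out, leaving the
    augmented simplicial boundary, read off at the face [t]. *)
Definition taylor_bdry (c : {set 'I_r} -> k) (t : {set 'I_r}) : k :=
  \sum_(j | j \notin t) taylor_sign j (j |: t) * c (j |: t).

(** The monomial quotients telescope. With truncated subtraction this requires the label of [s] to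
    divide [d], which the strand hypothesis gives wherever [c s] is nonzero. *)
Lemma taylor_diff_chain sigma i d c : taylor_strand sigma i d c ->
  taylor_diff u (taylor_chain d c) = taylor_chain d (taylor_bdry c).
Proof.
move=> cP; apply/ffunP => t; rewrite /taylor_diff sum_ffunE ffunE.
pose G (s : {set 'I_r}) (j : 'I_r) : {mpoly k[n]} :=
  (c s * taylor_sign j s) *: 'X_[k, (d - lcm_label u t)%MM].
transitivity (\sum_(s : {set 'I_r}) \sum_(j in s) (t == s :\ j)%:R * G s j).
  apply: eq_bigr => s _; rewrite !ffunE sum_ffunE.
  rewrite [LHS]mulr_sumr; apply: eq_bigr => j js.
  rewrite !ffunE /G /taylor_sign /= [X in _ * X = _]mulrC.
  case: eqP => [->|_]; last by rewrite !mul0r mulr0.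
  rewrite !mul1r.
  have [->|/cP[_ _ sd]] := eqVneq (c s) 0; first by rewrite mul0r !scale0r mul0r.
  have -> : (d - lcm_label u (s :\ j) =
      (d - lcm_label u s) + (lcm_label u s - lcm_label u (s :\ j)))%MM.
    by rewrite addmBA ?submK // lcm_label_sub // subsetDl.
  (* The sign is a polynomial on the left and a scalar on the right; both are reduced to the parity
     of the exponent. *)
  rewrite -signr_odd -[in RHS]signr_odd mulr_sign.
  have signE (a : k) (e : bool) (p q : {mpoly k[n]}) :
      a *: p * (if e then - q else q) = (a * (-1) ^+ e) *: (p * q).
    by case: e; rewrite ?expr1 ?mulr1 ?mulrN1 ?scaleNr ?mulrN -scalerAl.
  by rewrite mpolyXD; apply: signE.
(* For fixed [j], the only [s] containing [j] with [t = s :\ j] is [j |: t], and there is none if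
   [j] lies in [t]. *)
rewrite (exchange_big_dep xpredT) //= [RHS]scaler_suml.
rewrite [RHS]big_mkcond; apply: eq_bigr => j _.
case: ifPn => [jt|/negPn jt].
  rewrite (bigD1 (j |: t)) ?setU11 //= setU1K // eqxx mul1r big1 ?addr0.
    by rewrite /G [taylor_sign _ _ * _]mulrC.
  move=> s /andP[js sjt]; case: eqP => [e|_]; last by rewrite mul0r.
  by rewrite e setD1K ?eqxx in sjt.
rewrite big1 // => s js; case: eqP => [e|_]; last by rewrite mul0r.
by rewrite e !inE eqxx in jt.
Qed.

Lemma taylor_strand_bdry sigma i d c : taylor_strand sigma i.+1 d c ->
  taylor_strand sigma i d (taylor_bdry c).
Proof.
move=> cP t; rewrite /taylor_bdry => nz.
have /existsP[j /andP[jt cj]] : [exists j, (j \notin t) && (c (j |: t) != 0)].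
  apply: contraNT nz; rewrite negb_exists => /forallP H; apply/eqP/big1 => j jt.
  by have := H j; rewrite jt /= negbK => /eqP ->; rewrite mulr0.
have [sub card le] := cP _ cj; split.
- exact: subset_trans (subsetUr _ _) sub.
- by move: card; rewrite cardsU1 jt => -[].
- exact: lepm_trans (lcm_label_sub (subsetUr _ _)) le.
Qed.

Lemma taylor_chain_inj sigma i d c : taylor_strand sigma i d c ->
  taylor_chain d c = 0 -> c =1 fun=> 0.
Proof.
move=> cP /ffunP e s; have := e s; rewrite !ffunE.
move/(congr1 (mcoeff (d - lcm_label u s)%MM)).
by rewrite mcoeffZ mcoeffX eqxx mulr1 mcoeff0.
Qed.

(** Exterior multiplication by the vertex [v], the contracting homotopy of the simplex. *)
Definition taylor_cone (v : 'I_r) (c : {set 'I_r} -> k) (s : {set 'I_r}) : k :=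
  if v \in s then taylor_sign v s * c (s :\ v) else 0.

Lemma taylor_strand_cone (sigma : {set 'I_r}) i d c v : v \in sigma -> (u v <= d)%MM ->
  taylor_strand sigma i d c -> taylor_strand sigma i.+1 d (taylor_cone v c).
Proof.
move=> vs vd cP s; rewrite /taylor_cone; case: ifP => [vins|_]; last by rewrite eqxx.
rewrite mulf_eq0 negb_or => /andP[_ /cP[sub card le]].
split; first by rewrite -(setD1K vins) subUset sub1set vs.
- by rewrite (cardsD1 v) vins card.
- rewrite lcm_label_le; apply/forall_inP => j js.
  have [->//|jv] := eqVneq j v.
  by apply: lepm_trans le; apply: lcm_label_ge; rewrite !inE jv.
Qed.

(** Exactly one of [j < v] and [v < j] holds, so deleting two vertices in either order gives
    opposite signs. *)
Lemma taylor_sign_swap (v j : 'I_r) (t : {set 'I_r}) : v \in t -> j \notin t ->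
  taylor_sign j (j |: t) * taylor_sign v (j |: t) =
  - (taylor_sign v t * taylor_sign j (j |: t :\ v)).
Proof.
move=> vt jt; rewrite /taylor_sign.
have -> : #|[set l in j |: t | (l < v)%N]| = ((j < v) + #|[set l in t | (l < v)%N]|)%N.
  rewrite (cardsD1 j) !inE eqxx /=; congr addn; apply: eq_card => l; rewrite !inE.
  by case: eqVneq => // ->; rewrite (negPf jt).
have -> : #|[set l in j |: t | (l < j)%N]| =
    ((v < j) + #|[set l in j |: t :\ v | (l < j)%N]|)%N.
  rewrite (cardsD1 v) !inE vt orbT /=; congr addn; apply: eq_card => l; rewrite !inE.
  case: (eqVneq l v) => //= ->; rewrite orbF.
  by case: eqVneq => //= ->; rewrite ltnn.
have vj : (v != j :> nat) by apply: contraNneq jt => /val_inj <-.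
rewrite !exprD; case: (ltngtP v j) vj => //= _ _; rewrite ?expr1 ?expr0 ?mul1r ?mulN1r.
  by rewrite mulNr mulrC.
by rewrite mulrN mulrC.
Qed.

Lemma taylor_bdry_cone v (c : {set 'I_r} -> k) : taylor_bdry c =1 (fun=> 0) ->
  taylor_bdry (taylor_cone v c) =1 c.
Proof.
move=> c0 t; rewrite /taylor_bdry; have [vt|vt] := boolP (v \in t).
  (* The cycle equation at [t :\ v] expresses [c t] through the other terms, which
     [taylor_sign_swap] matches with the boundary of the cone. *)
  have := c0 (t :\ v); rewrite /taylor_bdry (bigD1 v) ?setD11 //= setD1K //.
  move/(congr1 (fun x => taylor_sign v t * x)); rewrite mulr0 mulrDr.
  rewrite mulrA -expr2 sqrr_sign mul1r => /eqP; rewrite addr_eq0 => /eqP ->.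
  rewrite mulr_sumr -sumrN [RHS](eq_bigl (fun j => j \notin t)); last first.
    move=> j; rewrite !inE negb_and negbK.
    case: eqVneq => [->|] /=; last by rewrite andbT.
    by rewrite vt.
  apply: eq_bigr => j jt.
  have jv : v != j by apply: contraNneq jt => <-.
  rewrite /taylor_cone !inE vt orbT !mulrA -mulNr -taylor_sign_swap //.
  congr (_ * c _); apply/setP => l; rewrite !inE.
  by case: eqVneq => // ->; rewrite (negPf jv).
(* Here only [j = v] contributes, as the cone vanishes at faces without [v]. *)
rewrite (bigD1 v) //= /taylor_cone setU11 mulrA -expr2 sqrr_sign mul1r setU1K //.
rewrite big1 ?addr0 // => j /andP[jt jv]; rewrite !inE eq_sym (negPf jv) (negPf vt).
by rewrite mulr0.
Qed.

End TaylorStrand.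

(** * Minimal generators of a squarefree monomial ideal *)

Section MonomialIdeal.
Variables (k : fieldType) (n : nat).

Lemma mcoeff_mul_mpolyX (p : {mpoly k[n]}) (m d : 'X_{1..n}) :
  (p * 'X_[m])@_d != 0 -> (m <= d)%MM.
Proof.
rewrite mcoeff_eq0 negbK (perm_mem (msuppMX _ _)) => /mapP[e _ ->].
exact: lem_addr.
Qed.

Lemma monomial_ideal_coeff r (u : 'I_r -> 'X_{1..n}) (s : {set 'I_r})
    (f : {mpoly k[n]}) d :
  monomial_ideal u s f -> f@_d != 0 -> exists2 i, i \in s & (u i <= d)%MM.
Proof.
move=> [c ->] nz.
have /existsP[i /andP[si /mcoeff_mul_mpolyX le]] :
    [exists i, (i \in s) && ((c i * 'X_[u i])@_d != 0)].
  apply: contraNT nz; rewrite negb_exists => /forallP H.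
  rewrite raddf_sum /=; apply/eqP/big1 => i si.
  by have := H i; rewrite si negbK => /eqP.
by exists i.
Qed.

Lemma monomial_ideal_mpolyX r (u : 'I_r -> 'X_{1..n}) (s : {set 'I_r}) i :
  i \in s -> monomial_ideal u s ('X_[u i] : {mpoly k[n]}).
Proof.
move=> si; exists (fun j => (j == i)%:R).
rewrite (bigD1 i) //= eqxx mul1r big1 ?addr0 // => j /andP[_ /negPf->].
exact: mul0r.
Qed.

Lemma minimal_generators_antichain (I : {mpoly k[n]} -> Prop) r
    (u : 'I_r -> 'X_{1..n}) i j :
  minimal_generators I u -> (u i <= u j)%MM -> i = j.
Proof.
move=> [uI umin] ij; apply/eqP/negPn/negP => nij.
suff /setP/(_ j) : [set~ j] = [set: 'I_r] by rewrite !inE eqxx.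
apply: umin => f; rewrite uI; split=> -[c ->].
  (* The generator [u j] is redundant: its multiples are absorbed into the coefficient of [u i]. *)
  exists (fun l => if l == i then c i + c j * 'X_[(u j - u i)%MM] else c l).
  rewrite (bigD1 j) ?in_setT //=. rewrite (bigD1 i) ?in_setT //=.
  rewrite [RHS](bigD1 i) ?inE //= eqxx.
  rewrite mulrDl addrA -mulrA -mpolyXD submK // [_ + c i * _]addrC; congr (_ + _).
  by apply: eq_big => [l|l /andP[_ /negPf->]]; rewrite ?inE.
exists (fun l => if l == j then 0 else c l).
rewrite [RHS](bigD1 j) ?in_setT //= eqxx mul0r add0r.
by apply: eq_big => [l|l]; rewrite !inE // => /negPf->.
Qed.

(** Some squarefree [w j] divides [u i], and some [u l] divides [w j]; the antichain property gives
    [l = i]. *)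
Lemma minimal_generators_squarefree (I : {mpoly k[n]} -> Prop) r
    (u : 'I_r -> 'X_{1..n}) i v :
  squarefree_monomial_ideal I -> minimal_generators I u -> (u i v <= 1)%N.
Proof.
move=> [q [w [wsf wI]]] umin; have [uI _] := umin.
have nz (m : 'X_{1..n}) : ('X_[m] : {mpoly k[n]})@_m != 0.
  by rewrite mcoeffX eqxx oner_neq0.
have /uI/wI/monomial_ideal_coeff/(_ (nz _))[j _ ji] :=
  monomial_ideal_mpolyX u (in_setT i).
have /wI/uI/monomial_ideal_coeff/(_ (nz _))[l _ lj] :=
  monomial_ideal_mpolyX w (in_setT j).
have e := minimal_generators_antichain umin (lepm_trans lj ji).
rewrite -e; exact: leq_trans (mnm_lepP lj v) (wsf j v).
Qed.

End MonomialIdeal.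

(** * Bihomogeneous elements and the irrelevant ideal *)

Section Bihomogeneous.
Variables (k : fieldType) (n : nat) (F : bigraded_free k n).
Implicit Types (i : nat) (d e : 'X_{1..n}) (x y : F).

Lemma bihom_hhom i d x : bihom i d x -> hhom i x.
Proof.
case=> c ->.
exists (fun j => if (bg_deg j <= d)%MM then c j *: 'X_[k, (d - bg_deg j)%MM] else 0).
by rewrite big_mkcond; apply: eq_bigr => j _; case: ifP; rewrite ?scale0r.
Qed.

Lemma bihom_zero i d : bihom i d (0 : F).
Proof. by exists (fun=> 0); rewrite big1 // => j _; rewrite !scale0r. Qed.

Lemma bihomD i d x y : bihom i d x -> bihom i d y -> bihom i d (x + y).
Proof.
move=> [a ->] [b ->]; exists (fun j => a j + b j).
by rewrite -big_split; apply: eq_bigr => j _; rewrite !scalerDl.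
Qed.

Lemma subm_self d : (d - d = 0)%MM.
Proof. by apply/mnmP => i; rewrite mnmBE subnn mnm0E. Qed.

Lemma mpolyX_shift (a b : k) d e f : (f <= e)%MM -> (e <= d)%MM ->
  (a *: 'X_[k, (d - e)%MM]) * (b *: 'X_[k, (e - f)%MM]) =
  (a * b) *: 'X_[k, (d - f)%MM].
Proof.
by move=> fe ed; rewrite -scalerAl -scalerAr -mpolyXD scalerA addmBA // submK.
Qed.

Lemma bihomZ i d e (a : k) x : (e <= d)%MM -> bihom i e x ->
  bihom i d ((a *: 'X_[k, (d - e)%MM]) *: x).
Proof.
move=> ed [c ->]; exists (fun j => if (bg_deg j <= e)%MM then a * c j else 0).
rewrite scaler_sumr big_mkcond [RHS]big_mkcond; apply: eq_bigr => j _.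
case: ifPn => je; last by case: ifP; rewrite ?scale0r.
by rewrite (lepm_trans je ed) scalerA mpolyX_shift.
Qed.

Lemma bihomN i d x : bihom i d x -> bihom i d (- x).
Proof.
move=> [a ->]; exists (fun j => - a j).
by rewrite -sumrN; apply: eq_bigr => j _; rewrite !scaleNr.
Qed.

Lemma bihom_basis i (j : 'I_(bg_rank F i)) : bihom i (bg_deg j) (bg_basis j).
Proof.
exists (fun l => (l == j)%:R); rewrite (bigD1 j) ?lepm_refl //= eqxx big1 => [|l].
  by rewrite addr0 scale1r subm_self mpolyX0 scale1r.
by case/andP=> _ /negPf->; rewrite !scale0r.
Qed.

(** Padding by zeros allows finitely many elements to be expanded over one common range of
    homological degrees. *)
Lemma bg_span_eventually x :
  exists N0 : nat, exists c : forall i, 'I_(bg_rank F i) -> {mpoly k[n]},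
  forall N, (N0 <= N)%N -> x = \sum_(i < N) \sum_j c i j *: bg_basis j.
Proof.
have [N [c ->]] := bg_span x; exists N.
exists (fun i j => if (i < N)%N then c i j else 0) => M NM.
rewrite (big_ord_widen M (fun i => \sum_(j < bg_rank F i) c i j *: bg_basis j)) //.
rewrite big_mkcond; apply: eq_bigr => i _; case: ifP => // _.
by rewrite big1 // => j _; rewrite scale0r.
Qed.

Lemma coeff0_basis_sum i (c : 'I_(bg_rank F i) -> {mpoly k[n]}) (y : 'I_n -> F) :
  \sum_j c j *: bg_basis j = \sum_v 'X_v *: y v -> forall j, (c j)@_0%MM = 0.
Proof.
have [N /fin_all_exists[a yE]] := fin_all_exists (fun v => bg_span_eventually (y v)).
pose M := maxn i.+1 (\max_v N v).
have {}yE v : y v = \sum_(i < M) \sum_j a v i j *: bg_basis j.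
  by apply: yE; rewrite leq_max (leq_bigmax v) orbT.
(* Freeness is stated for families over all homological degrees, so [c] is extended by zero outside
   degree [i]; the index type depends on the degree, hence the cast. *)
have [D [Di D0]] : exists D : forall i, 'I_(bg_rank F i) -> {mpoly k[n]},
    D i = c /\ forall l j, l != i -> D l j = 0.
  exists (fun l => if i =P l is ReflectT e
    then ecast l ('I_(bg_rank F l) -> {mpoly k[n]}) e c else fun=> 0).
  split=> [|l j]; first by case: eqP => // e; rewrite eq_axiomK.
  by case: eqP => // e /negP[]; rewrite e.
have iM : (i < M)%N by rewrite leq_max leqnn.
move=> E j.
have /(_ i j iM) : forall i j, (i < M)%N -> D i j - \sum_v 'X_v * a v i j = 0.
  apply: bg_free.
  under eq_bigr do under eq_bigr do rewrite scalerBl.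
  under eq_bigr do rewrite sumrB.
  rewrite sumrB (bigD1 (Ordinal iM)) //= Di [X in _ + X - _]big1 ?addr0 => [|l li].
    apply/eqP; rewrite subr_eq0 E; apply/eqP.
    transitivity (\sum_v \sum_(l < M) \sum_j ('X_v * a v l j) *: bg_basis j).
      apply: eq_bigr => v _; rewrite yE scaler_sumr; apply: eq_bigr => l _.
      by rewrite scaler_sumr; apply: eq_bigr => t _; rewrite scalerA.
    rewrite exchange_big; apply: eq_bigr => l _.
    by rewrite exchange_big; apply: eq_bigr => t _; rewrite scaler_suml.
  by rewrite big1 // => t _; rewrite D0 ?scale0r.
move/eqP; rewrite Di subr_eq0 => /eqP ->.
rewrite raddf_sum /= big1 // => v _; rewrite rmorphM /= mcoeffX.
by rewrite mnm1_eq0 mul0r.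
Qed.

(** The coordinate at a basis element of degree exactly [d] is a scalar, and a scalar in the
    irrelevant ideal is zero. *)
Lemma bihom_irrelevant i d x (y : 'I_n -> F) : bihom i d x ->
  x = \sum_v 'X_v *: y v ->
  exists c : 'I_(bg_rank F i) -> k,
    x = \sum_(j | (bg_deg j <= d)%MM && (bg_deg j != d))
          (c j *: 'X_[k, (d - bg_deg j)%MM]) *: bg_basis j.
Proof.
move=> [c xE] xm; exists c.
rewrite {1}xE (bigID (fun j => bg_deg j == d)) /= big1 ?add0r // => j /andP[_ /eqP jd].
have : \sum_j (if (bg_deg j <= d)%MM then c j *: 'X_[k, (d - bg_deg j)%MM] else 0)
    *: bg_basis j = \sum_v 'X_v *: y v.
  rewrite -xm xE [RHS]big_mkcond; apply: eq_bigr => l _.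
  by case: ifP; rewrite ?scale0r.
move/coeff0_basis_sum/(_ j); rewrite jd lepm_refl mcoeffZ subm_self mpolyX0.
by rewrite mcoeff1 eqxx mulr1 => ->; rewrite !scale0r.
Qed.

End Bihomogeneous.

(** * The Taylor complex on a Scarf face inside the minimal resolution *)

Section ScarfImage.
Variables (k : fieldType) (n r : nat) (I : {mpoly k[n]} -> Prop).
Variables (u : 'I_r -> 'X_{1..n}) (F : dg_algebra k n).
Variables (phi : {linear taylor k n r -> F}) (sigma : {set 'I_r}).
Hypotheses (u_min : minimal_generators I u) (F_res : free_resolution I F).
Hypotheses (F_min : minimal F) (phi_scarf : scarf_embedding u phi).
Hypothesis (sigma_scarf : scarf_face u sigma).
Implicit Types (i : nat) (d e : 'X_{1..n}).

Definition scarf_image i d (x : F) : Prop :=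
  exists2 c, taylor_strand u sigma i d c & x = phi (taylor_chain u d c).

Lemma taylor_strand_in_scarf i d c :
  taylor_strand u sigma i d c -> @in_scarf k n r u (taylor_chain u d c).
Proof.
move=> cP s ns; rewrite ffunE.
have [->|/cP[sub _ _]] := eqVneq (c s) 0; first by rewrite scale0r.
by rewrite (scarf_face_sub sigma_scarf sub) in ns.
Qed.

Lemma scarf_image_zero i d : scarf_image i d 0.
Proof.
exists (fun=> 0) => [s|]; first by rewrite eqxx.
rewrite -[LHS](linear0 phi); congr (phi _).
by apply/ffunP => s; rewrite !ffunE scale0r.
Qed.

Lemma scarf_imageD i d x y :
  scarf_image i d x -> scarf_image i d y -> scarf_image i d (x + y).
Proof.
move=> [a aP ->] [b bP ->]; exists (fun s => a s + b s) => [s|].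
  have [-> |/aP //] := eqVneq (a s) 0; rewrite add0r; exact: bP.
rewrite -linearD; congr (phi _).
by apply/ffunP => s; rewrite !ffunE scalerDl.
Qed.

Lemma scarf_imageZ i d e (a : k) x : (e <= d)%MM -> scarf_image i e x ->
  scarf_image i d ((a *: 'X_[k, (d - e)%MM]) *: x).
Proof.
move=> ed [c cP ->]; exists (fun s => a * c s) => [s|].
  rewrite mulf_eq0 negb_or => /andP[_ /cP[sub card le]].
  split=> //; exact: lepm_trans le ed.
rewrite -linearZ; congr (phi _); apply/ffunP => s; rewrite !ffunE.
have [->|/cP[_ _ le]] := eqVneq (c s) 0; first by rewrite mulr0 !scale0r scaler0.
exact: mpolyX_shift.
Qed.

Lemma phi_taylor_chain d c : phi (taylor_chain u d c) =
  \sum_s (c s *: 'X_[k, (d - lcm_label u s)%MM]) *: phi (taylor_basis k n s).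
Proof.
transitivity (phi (\sum_s (c s *: 'X_[k, (d - lcm_label u s)%MM])
                     *: taylor_basis k n s)).
  congr (phi _); apply/ffunP => t; rewrite sum_ffunE !ffunE.
  rewrite (bigD1 t) //= big1 => [|s st]; rewrite !ffunE.
    by rewrite eqxx addr0 [RHS]mulr1.
  by rewrite eq_sym (negPf st) scaler0.
by rewrite linear_sum; apply: eq_bigr => s _; rewrite linearZ.
Qed.

Lemma scarf_image_bihom i d x : scarf_image i d x -> bihom i d x.
Proof.
move=> [c cP ->]; rewrite phi_taylor_chain.
apply: (big_ind (bihom i d)) => [||s _]; [exact: bihom_zero|exact: bihomD|].
have [->|/cP[sub <- le]] := eqVneq (c s) 0.
  by rewrite !scale0r; exact: bihom_zero.
apply: bihomZ => //; have [+ _ _ _] := phi_scarf; apply.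
exact: scarf_face_sub sub.
Qed.

(* Minimality: a boundary of degree [d] involves only basis elements of degree
   strictly smaller than [d]. *)
Lemma scarf_image_boundary i d x :
    (forall e y, (e <= d)%MM -> e != d -> bihom i e y -> scarf_image i e y) ->
  bihom i d x -> (exists y, diff F y = x) -> scarf_image i d x.
Proof.
move=> IHd xP [y yx]; have [z zE] := F_min y; rewrite yx in zE.
have [c ->] := bihom_irrelevant xP zE.
apply: (big_ind (scarf_image i d)) => [||j /andP[le ne]].
- exact: scarf_image_zero.
- exact: scarf_imageD.
- apply: scarf_imageZ => //; apply: IHd => //; exact: bihom_basis.
Qed.

Lemma phi_set0 : phi (taylor_basis k n set0) = dunit F.
Proof.
have [_ _ _ unit0] := phi_scarf.
exact/unit0/(scarf_face_sub sigma_scarf)/sub0set.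
Qed.

Lemma dunit_neq0 : dunit F != 0.
Proof.
rewrite -phi_set0; apply/eqP => e; have [_ _ phi_inj _] := phi_scarf.
have /phi_inj/(_ e)/ffunP/(_ set0) : @in_scarf k n r u (taylor_basis k n set0).
  move=> s; rewrite ffunE; case: eqP => // ->.
  by rewrite (scarf_face_sub sigma_scarf (sub0set _)).
by rewrite !ffunE eqxx => /eqP; rewrite oner_eq0.
Qed.

Lemma diff_scarf_image i d c : taylor_strand u sigma i d c ->
  diff F (phi (taylor_chain u d c)) = phi (taylor_chain u d (taylor_bdry c)).
Proof.
move=> cP; have [_ dphi _ _] := phi_scarf.
by rewrite dphi ?(taylor_diff_chain cP) //; apply: taylor_strand_in_scarf cP.
Qed.

Lemma taylor_bdry_cycle i d c : taylor_strand u sigma i d c ->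
  diff F (phi (taylor_chain u d c)) = 0 -> taylor_bdry c =1 fun=> 0.
Proof.
(* In homological degree 0, [c] is supported on the empty face, whereas [j |: t] is nonempty. *)
case: i => [cP _ t|i cP].
  rewrite /taylor_bdry big1 // => j jt; apply/eqP; rewrite mulf_eq0.
  apply/orP; right; apply/negPn/negP => /cP[_ card _].
  by rewrite cardsU1 jt in card.
rewrite (diff_scarf_image cP) => e; have [_ _ phi_inj _] := phi_scarf.
have bP := taylor_strand_bdry cP.
by apply: (taylor_chain_inj bP); apply: phi_inj e; apply: taylor_strand_in_scarf bP.
Qed.

(** If [a] were zero, the unit would be a boundary. By minimality it would then be a combination of
    basis elements of degree strictly dividing 1, hence zero, contradicting the injectivity of [phi]
    on the Scarf complex. *)
Lemma augmentation_dunit (eps : {linear F -> {mpoly k[n]}^o}) :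
    (forall m (x : F), bihom 0 m x -> exists c : k, eps x = c *: 'X_[m]) ->
    (forall x : F, hhom 0 x ->
           (I (eps x) <-> exists y : F, hhom 1 y /\ diff F y = x)) ->
  exists2 a : k, a != 0 & forall p, eps (p *: dunit F) = a *: p.
Proof.
move=> epsX epsI; have [a ea] := epsX _ _ (dunit_bihom F).
exists a => [|p]; last first.
  have scaleE (q : {mpoly k[n]}) : p * (a *: q) = a *: (p * q) by rewrite -scalerAr.
  by rewrite linearZ ea mpolyX0 -[RHS]mulr1 -scalerAl -scaleE.
apply/eqP => a0; have [uI _] := u_min.
have : I (eps (dunit F)).
  apply/uI; rewrite ea a0 scale0r; exists (fun=> 0).
  by rewrite big1 // => i _; rewrite mul0r.
case/(epsI _ (bihom_hhom (dunit_bihom F))) => y [_ yE].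
have [z zE] := F_min y; rewrite yE in zE.
have [c cE] := bihom_irrelevant (dunit_bihom F) zE.
case/eqP: dunit_neq0; rewrite cE big1 // => j /andP[/mnm_lepP le /eqP[]].
by apply/mnmP => l; have := le l; rewrite mnm0E leqn0 => /eqP.
Qed.

Lemma scarf_image_dunit : scarf_image 0 0%MM (dunit F).
Proof.
exists (fun s => (s == set0)%:R) => [s|].
  have [-> _|_] := eqVneq s set0; last by rewrite eqxx.
  split; rewrite ?sub0set ?cards0 // lcm_label_le.
  by apply/forall_inP => j; rewrite inE.
rewrite -phi_set0; congr (phi _); apply/ffunP => s; rewrite !ffunE sub0m mpolyX0.
by case: eqP => _; rewrite ?scale1r ?scale0r.
Qed.

Lemma taylor_chain_dunit d c : taylor_strand u sigma 0 d c ->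
  phi (taylor_chain u d c) =
  (c set0 *: 'X_[k, (d - lcm_label u set0)%MM]) *: dunit F.
Proof.
move=> cP; rewrite phi_taylor_chain (bigD1 set0) //= phi_set0 big1 ?addr0 // => s s0.
have [->|/cP[_ /eqP]] := eqVneq (c s) 0; first by rewrite !scale0r.
by rewrite cards_eq0 (negPf s0).
Qed.

Lemma taylor_strand_exact i d x c : (forall j, (u j <= d)%MM -> j \in sigma) ->
    bihom i.+1 d x -> taylor_strand u sigma i d c ->
    diff F x = phi (taylor_chain u d c) ->
  exists2 z, taylor_strand u sigma i.+1 d z & taylor_bdry z =1 c.
Proof.
move=> dsigma xP cP dxE.
have c0 : taylor_bdry c =1 fun=> 0.
  by apply: taylor_bdry_cycle cP _; rewrite -dxE diffK.
case: (pickP (fun s => c s != 0)) => [s cs|c_0]; last first.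
  exists (fun=> 0) => [s|t]; first by rewrite eqxx.
  have := c_0 t => /negbFE/eqP ->.
  by rewrite /taylor_bdry big1 // => j _; rewrite mulr0.
(* Such a [v] lies in [sigma] and serves as the apex of a cone bounding [c]. *)
suff [v vd] : exists v, (u v <= d)%MM.
  have vs := dsigma _ vd.
  by exists (taylor_cone v c); [exact: taylor_strand_cone|exact: taylor_bdry_cone].
have [sub card le] := cP _ cs.
have [s0|[v vs]] := set_0Vmem s; last first.
  by exists v; exact: lepm_trans (lcm_label_ge u vs) le.
(* On the empty face no vertex is at hand. Instead, the boundary of [x] is a nonzero scalar times a
   monomial times the unit, and its augmentation lies in [I], so some generator divides that
   monomial. *)
move: card; rewrite s0 cards0 => i0; rewrite -i0 in xP cP; rewrite s0 in cs.
have [_ [eps [epsX _ epsI]]] := F_res.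
have [a a0 epsU] := augmentation_dunit epsX epsI.
have [uI _] := u_min.
have /uI/monomial_ideal_coeff : I (eps (diff F x)).
  apply/(epsI _ (bihom_hhom (diff_bihom xP))).
  by exists x; split=> //; exact: bihom_hhom xP.
rewrite dxE taylor_chain_dunit // epsU.
case/(_ (d - lcm_label u set0)%MM) => [|v _ vd].
  by rewrite !mcoeffZ mcoeffX eqxx mulr1 mulf_neq0.
by exists v; exact: lepm_trans vd (lem_subr _ _).
Qed.

Lemma lepm_neq_mdeg e d : (e <= d)%MM -> e != d -> (mdeg e < mdeg d)%N.
Proof.
move=> ed ne; rewrite -(submK ed) mdegD -[X in (X < _)%N]add0n ltn_add2r.
rewrite lt0n mdeg_eq0; apply: contraNneq ne => e0.
by rewrite -(submK ed) e0 add0m.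
Qed.

(* Graded Nakayama, as an induction on the degree. *)
Lemma scarf_image_nakayama i :
    (forall d x, (forall j, (u j <= d)%MM -> j \in sigma) -> bihom i d x ->
       exists2 y, scarf_image i d y & exists w, diff F w = x - y) ->
  forall d x, (forall j, (u j <= d)%MM -> j \in sigma) ->
    bihom i d x -> scarf_image i d x.
Proof.
move=> approx d x; have [N] := ubnP (mdeg d).
elim: N d x => // N IHN d x dN dsigma xP.
have [y yS bdry] := approx d x dsigma xP.
rewrite -[x](subrK y); apply: scarf_imageD => //.
apply: scarf_image_boundary bdry => [e z ed ne|].
  apply: IHN => [|j je]; last exact/dsigma/(lepm_trans je).
  exact: leq_trans (lepm_neq_mdeg ed ne) _.
exact/bihomD/bihomN/scarf_image_bihom.
Qed.

Lemma scarf_image_surj i d x : (forall j, (u j <= d)%MM -> j \in sigma) ->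
  bihom i d x -> scarf_image i d x.
Proof.
have [Fexact [eps [epsX _ epsI]]] := F_res.
have [a a0 epsU] := augmentation_dunit epsX epsI.
elim: i d x => [|i IHi]; apply: scarf_image_nakayama => d x dsigma xP.
  have [b xb] := epsX _ _ xP.
  (* As [eps] sends the unit to [a], this multiple of the unit has the augmentation of [x]; so
     [x - y] is a boundary. *)
  pose y := ((b / a) *: 'X_[k, (d - 0)%MM]) *: dunit F.
  have yS : scarf_image 0 d y.
    by apply: scarf_imageZ scarf_image_dunit; apply/mnm_lepP => l; rewrite mnm0E.
  have xyP := bihomD xP (bihomN (scarf_image_bihom yS)).
  exists y => //; have [uI _] := u_min.
  have /(epsI _ (bihom_hhom xyP))[w [_ <-]] : I (eps (x - y)); last by exists w.
  apply/uI; exists (fun=> 0); rewrite big1 => [|j _]; last by rewrite mul0r.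
  by rewrite linearB /= epsU xb subm0 scalerA mulrC divfK // subrr.
(* The boundary of [x] lifts to a Taylor boundary of some [z]; then [x] minus the image of [z] is a
   cycle, hence a boundary. *)
have [c cP dxE] := IHi _ _ dsigma (diff_bihom xP).
have [z zP zc] := taylor_strand_exact dsigma xP cP dxE.
have zS : scarf_image i.+1 d (phi (taylor_chain u d z)) by exists z.
have xzP := bihomD xP (bihomN (scarf_image_bihom zS)).
exists (phi (taylor_chain u d z)) => //.
have [|w [_ wE]] := Fexact _ _ (bihom_hhom xzP); last by exists w.
rewrite linearB /= dxE (diff_scarf_image zP).
apply/eqP; rewrite subr_eq0; apply/eqP; congr (phi _).
by apply/ffunP => s; rewrite !ffunE zc.
Qed.

End ScarfImage.

(** * Vanishing of the divided powers *)

Theorem proposition5p6 (k : fieldType) (n : nat) (I : {mpoly k[n]} -> Prop)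
    (r : nat) (u : 'I_r -> 'X_{1..n}) (F : dg_gamma_algebra k n)
    (phi : {linear taylor k n r -> F})
    (I_squarefree : squarefree_monomial_ideal I)
    (u_min : minimal_generators I u)
    (F_res : free_resolution I F) (F_min : minimal F)
    (phi_scarf : scarf_embedding u phi)
    (sigma : {set 'I_r}) (sigma_scarf : scarf_face u sigma)
    (sigma_even : even_pos #|sigma|) (m : nat) (m_ge2 : (2 <= m)%N) :
  dpow (phi (taylor_basis k n sigma)) m = (0 : F)%R.
Proof.
have [phi_bihom _ _ _] := phi_scarf.
have powP := dpow_bihom m sigma_even (phi_bihom _ sigma_scarf).
(* The exponents of [u j] are at most 1, so [u j] divides a power of the label of [sigma] only if it
   divides the label itself. *)
have below j : (u j <= lcm_label u sigma *+ m)%MM -> j \in sigma.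
  move=> /mnm_lepP le; apply: scarf_face_mem sigma_scarf _.
  apply/mnm_lepP => v; have := le v; rewrite mulmnE.
  have := minimal_generators_squarefree j v I_squarefree u_min.
  by case: (u j v) => [|[|]] //; case: (lcm_label u sigma v).
have [c cP ->] := scarf_image_surj u_min F_res F_min phi_scarf sigma_scarf below powP.
rewrite -[RHS](linear0 phi); congr (phi _); apply/ffunP => s; rewrite !ffunE.
(* A face with nonzero coefficient would be a subset of [sigma] with [m * #|sigma|] elements. *)
have [->|/cP[/subset_leq_card le card _]] := eqVneq (c s) 0; first by rewrite scale0r.
have /andP[_ pos] := sigma_even.
by move: le; rewrite card leqNgt -{1}[#|sigma|]mul1n ltn_pmul2r // m_ge2.
Qed.
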